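(* Let $k\ge 1$ and $n\ge 1$ be integers. The number $d_n((UD)^k)$ of Dyck paths of semilength $n$ avoiding the pattern $(UD)^k$ is $$d_n((UD)^k)=\sum_{i=0}^{k-1}N_{n,i},$$ where $N_{n,i}$ are the Narayana numbers.
   Context: A Dyck path of semilength $n$ is a word of length $2n$ on the alphabet $\{U,D\}$ with $n$ letters $U$ and $n$ letters $D$ in which every prefix contains at least as many $U$'s as $D$'s. A Dyck path $Q$ contains the pattern $P$ (another Dyck path) if $P$ is a (not necessarily contiguous) subword, i.e. subsequence, of $Q$; otherwise $Q$ avoids $P$. $(UD)^k$ denotes the word $UD$ repeated $k$ times. For $n\ge 1$, the Narayana numbers are $N_{n,i}=\frac1n\binom{n}{i}\binom{n}{i-1}$ for $i\ge 1$ and $N_{n,0}=0$. *)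

(* Defs.v *)
From mathcomp Require Import all_boot all_order all_algebra.

Set Implicit Arguments.
Unset Strict Implicit.
Unset Printing Implicit Defensive.

Import GRing.Theory.

(* Words on the alphabet {U, D} are Boolean sequences. *)
Definition U : bool := true.
Definition D : bool := false.

Definition dyck_path (n : nat) (w : seq bool) : bool :=
  [&& size w == n.*2, count_mem U w == n, count_mem D w == n &
      [forall j : 'I_(size w).+1,
         count_mem D (take j w) <= count_mem U (take j w)]].

Definition contains (P Q : seq bool) : bool := subseq P Q.

Definition avoids (P Q : seq bool) : bool := ~~ contains P Q.

Definition num_avoiding (n : nat) (P : seq bool) : nat :=
  #|[set Q : n.*2.-tuple bool | dyck_path n Q && avoids P Q]|.

Definition UD_pow (k : nat) : seq bool := flatten (nseq k [:: U; D]).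

(* Rational-valued, so that the factor 1/n is a genuine division. *)
Definition narayana (n i : nat) : rat :=
  if i is j.+1 then (n%:R^-1 * 'C(n, j.+1)%:R * 'C(n, j)%:R)%R else 0%R.

(* Main.v *)
Require Import Defs.
From mathcomp Require Import all_boot all_order all_algebra.
From mathcomp Require Import zify.

(** A word contains [(UD)^k] iff it has at least [k] peaks, so the theorem
    amounts to the count of Dyck paths by number of peaks.  Read from right to
    left, the number [T(a, b, p)] of words with [a] letters [D], [b] letters [U]
    and [p] peaks, all of whose suffixes contain at least as many [D]'s as
    [U]'s, satisfies
      [T(a+1,b+1,p) - T(a,b+1,p) - T(a+1,b,p) + T(a,b,p) = T(a,b,p-1)]
    for [b <= a], with [T(a,a+1,p) = 0].  Without the suffix condition the count
    is [C(a,p) C(b,p)], which satisfies the same recurrence; the reflected term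
    [C(b-1,p) C(a+1,p)] satisfies it too and agrees with it on the line
    [b = a+1].  Hence [T] is their difference, and for [a = b = n] it is the
    Narayana number. *)

Set Implicit Arguments.
Unset Strict Implicit.
Unset Printing Implicit Defensive.

Import GRing.Theory.

(** The default [true] of [head] means that a final [U] is not a peak. *)
Fixpoint peaks (w : seq bool) : nat :=
  if w is c :: w' then (c && ~~ head true w') + peaks w' else 0.

(** Greedy matching has two states: awaiting [U] or awaiting [D]. In the second, the [U] already
    matched acts as a letter in front of [w]. Each state leads to the other, so both claims share
    one induction. *)
Lemma subseq_UD_pow w k :
  (subseq (UD_pow k) w = (k <= peaks w)) *
  (subseq (D :: UD_pow k) w = (k < peaks (U :: w))).
Proof.
elim: w k => [|[] w IHw] k; first by split => //; case: k.
- by split; [case: k => [|k]; [|exact: (IHw k).2] | exact: (IHw k).2].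
- by split; [case: k => [|k]; [|exact: (IHw k.+1).1] | exact: (IHw k).1].
Qed.

Fixpoint suffix_ballot (w : seq bool) : bool :=
  if w is _ :: w' then (count_mem U w <= count_mem D w) && suffix_ballot w'
  else true.

Lemma suffix_ballotP w :
  reflect (forall j, count_mem U (drop j w) <= count_mem D (drop j w))
          (suffix_ballot w).
Proof.
elim: w => [|c w IHw]; first by apply: ReflectT => j.
apply: (iffP andP) => [[le_w /IHw Hw] [|j]|Hw]; [exact: le_w | exact: Hw |].
by split; [exact: (Hw 0) | apply/IHw => j; exact: (Hw j.+1)].
Qed.

Lemma suffix_ballot_count w :
  suffix_ballot w -> count_mem U w <= count_mem D w.
Proof. by case: w => //= c w /andP[]. Qed.

Definition ballot (a b : nat) (w : seq bool) : bool :=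
  [&& count_mem D w == a, count_mem U w == b & suffix_ballot w].

(** Each letter occurs [n] times in all, so a prefix with no excess of [D] leaves a suffix with no
    excess of [U]. *)
Lemma dyck_pathE n w : dyck_path n w = (size w == n.*2) && ballot n n w.
Proof.
rewrite /dyck_path /ballot; case: (size w == _) => //=.
case: eqP => [eqU|]; case: eqP => [eqD|] //=.
apply/forallP/suffix_ballotP => Hw j.
- case: (leqP j (size w)) => [le_j|lt_j]; last by rewrite drop_oversize // ltnW.
  have := Hw (Ordinal (le_j : j < (size w).+1)); move: eqU eqD => /=.
  rewrite -{1 2}(cat_take_drop j w) !count_cat; lia.
- have := Hw j; move: eqU eqD; rewrite -{1 2}(cat_take_drop j w) !count_cat.
  rewrite /=; lia.
Qed.

Fixpoint words (m : nat) : seq (seq bool) :=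
  if m is m'.+1 then map (cons U) (words m') ++ map (cons D) (words m')
  else [:: [::]].

Lemma mem_words m w : (w \in words m) = (size w == m).
Proof.
elim: m w => [|m IHm] w /=; first by rewrite inE; case: w.
rewrite mem_cat; case: w => [|c w].
  by apply/norP; split; apply/negP => /mapP[].
rewrite eqSS -IHm; apply/orP/idP => [[] /mapP[v vm [_ ->]] //|wm].
by case: c; [left|right]; apply/mapP; exists w.
Qed.

Lemma words_uniq m : uniq (words m).
Proof.
elim: m => //= m IHm; rewrite cat_uniq !map_inj_uniq ?IHm ?andbT /=;
  try by move=> ? ? [].
by apply/hasPn => _ /mapP[v _ ->]; apply/negP => /mapP[].
Qed.

Lemma card_tuple_words m (P : pred (seq bool)) :
  #|[set t : m.-tuple bool | P t]| = count P (words m).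
Proof.
rewrite cardsE cardE size_filter -enumT -(count_map val P).
apply/permP/uniq_perm; rewrite ?words_uniq //.
  by rewrite (map_inj_uniq val_inj) enum_uniq.
move=> w; rewrite mem_words; apply/mapP/idP => [[t _ ->]|sz_w].
  by rewrite size_tuple.
by exists (Tuple sz_w); rewrite ?mem_enum.
Qed.

Lemma count_wordsS m (P : pred (seq bool)) :
  count P (words m.+1) =
  count (fun w => P (U :: w)) (words m) + count (fun w => P (D :: w)) (words m).
Proof. by rewrite /= count_cat !count_map. Qed.

Definition ballot_peaks (a b p : nat) (w : seq bool) : bool :=
  ballot a b w && (peaks w == p).

Definition num_ballot (a b p : nat) : nat :=
  count (ballot_peaks a b p) (words (a + b)).

(** The leading [U] is not part of the enumerated word: these are the words with
    [a] letters [D] and [b.+1] letters [U] that start with [U]. *)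
Definition num_ballot_U (a b p : nat) : nat :=
  count (fun w => ballot_peaks a b.+1 p (U :: w)) (words (a + b)).

Lemma num_ballot_gt a b p : a < b -> num_ballot a b p = 0.
Proof.
move=> lt_ab; apply/eqP; rewrite -leqn0 leqNgt -has_count; apply/hasPn => w _.
apply/negP => /andP[/and3P[/eqP eqD /eqP eqU /suffix_ballot_count]].
by rewrite eqD eqU leqNgt lt_ab.
Qed.

Lemma num_ballotS0 a p : num_ballot a.+1 0 p = num_ballot a 0 p.
Proof.
rewrite /num_ballot addSn count_wordsS addn0.
rewrite (@eq_count _ _ pred0) ?count_pred0; last first.
  by move=> w; rewrite /ballot_peaks /ballot /= andbF.
apply: eq_count => w; rewrite /ballot_peaks /ballot /= !add0n add1n eqSS.
by case: eqP => //= _; case: eqP => [->|].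
Qed.

Lemma num_ballotSS a b p : b <= a ->
  num_ballot a.+1 b.+1 p = num_ballot_U a.+1 b p + num_ballot a b.+1 p.
Proof.
move=> le_ba; rewrite /num_ballot addSn count_wordsS; congr (_ + _).
  by rewrite /num_ballot_U addSnnS.
apply: eq_count => w; rewrite /ballot_peaks /ballot /= !add0n add1n eqSS.
by case: eqP => //= ->; case: eqP => //= ->; rewrite ltnS le_ba.
Qed.

Lemma num_ballot_US a b p : b <= a -> num_ballot_U a.+1 b p =
  (if b is b'.+1 then num_ballot_U a.+1 b' p else 0) +
  (if p is q.+1 then num_ballot a b q else 0).
Proof.
move=> le_ba; rewrite /num_ballot_U addSn count_wordsS; congr (_ + _).
- case: b le_ba => [|b] le_ba.
    rewrite -[RHS](count_pred0 (words (a + 0))); apply: eq_count => w.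
    by rewrite /ballot_peaks /ballot /= andbF.
  rewrite addSnnS; apply: eq_count => w.
  rewrite /ballot_peaks /ballot /= !add1n !add0n eqSS.
  case: eqP => //= ->; case: eqP => //= -[->].
  by rewrite !ltnS le_ba (ltnW le_ba).
- case: p => [|p]; [rewrite -[RHS](count_pred0 (words (a + b)))|];
    apply: eq_count => w; rewrite /ballot_peaks /ballot /= ?andbF //.
  rewrite !add0n !add1n !eqSS.
  case: eqP => //= ->; case: eqP => //= ->.
  by rewrite !ltnS le_ba leqW.
Qed.

(** The reflected term is added on the left to avoid truncated subtraction. *)
Lemma num_ballotE a b p : b <= a.+1 ->
  num_ballot a b p + (if b is b'.+1 then 'C(b', p) * 'C(a.+1, p) else 0) =
  'C(a, p) * 'C(b, p).
Proof.
elim: a b p => [|a IHa] b p le_b.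
  by case: b le_b => [|[|//]] _; [case: p | rewrite num_ballot_gt].
(* Closed form for words starting with [U]: induction on [c] sums the terms [num_ballot a c q]
   supplied by [IHa]. *)
have UE c q : c <= a -> num_ballot_U a.+1 c q.+1 + 'C(c, q.+1) * 'C(a.+1, q) =
    'C(a, q) * 'C(c.+1, q.+1).
  elim: c => [|c IHc] le_c; rewrite num_ballot_US //.
    by have := IHa 0 q isT; rewrite binS (bin0n q.+1) /=; nia.
  have := IHc (ltnW le_c); have := IHa c.+1 q (ltnW le_c).
  by rewrite /= !binS; nia.
(* A word starting with [U] that satisfies the suffix condition has a peak. *)
have U0 c : c <= a -> num_ballot_U a.+1 c 0 = 0.
  by elim: c => [|c IHc] le_c; rewrite num_ballot_US // IHc // ltnW.
case: b le_b => [_|b].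
  rewrite num_ballotS0 (IHa 0 p isT).
  by case: p => [|p]; rewrite ?bin0 // bin0n !muln0.
(* On the line [b = a + 1] the two products coincide. *)
rewrite ltnS leq_eqVlt => /orP[/eqP->|lt_b].
  by rewrite num_ballot_gt // mulnC.
rewrite num_ballotSS //; have := IHa b.+1 p lt_b; case: p => [|p].
  by rewrite U0 // !bin0.
have := UE b p lt_b; rewrite !(binS a.+1) !(binS a) !(binS b); nia.
Qed.

Lemma mul_num_ballot n p :
  n * num_ballot n n p.+1 = 'C(n, p.+1) * 'C(n, p).
Proof.
case: n => [|m]; first by case: p.
have [lt_mp|le_pm] := ltnP m p.
  have := num_ballotE p.+1 (leqnSn m.+1).
  rewrite (@bin_small m.+1) // !muln0 => /eqP; rewrite addn_eq0.
  by case/andP=> /eqP-> _; rewrite muln0.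
have [r defm] : exists r, m = p + r by exists (m - p); rewrite subnKC.
have := num_ballotE p.+1 (leqnSn m.+1); rewrite /= (binS m.+1 p).
have := mul_bin_diag m.+1 p; have := mul_bin_left m.+1 p.
rewrite /= (binS m p); have -> : m.+1 - p = r.+1 by lia.
move: ('C(m, p)) ('C(m, p.+1)) ('C(m.+1, p)) (num_ballot _ _ _) => x y w t.
rewrite {m le_pm}defm => e3 e1 e0.
(* With these multiples of the hypotheses, the goal is a linear combination of monomials. *)
have e4 := congr1 (muln (y + x)) e3; have e5 := congr1 (muln (y + x)) e1.
have e6 := congr1 (muln w) e1; have e7 := congr1 (muln (p + r).+1) e0.
nia.
Qed.

Lemma num_ballot_narayana n p : 0 < n ->
  ((num_ballot n n p)%:R = narayana n p :> rat)%R.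
Proof.
move=> n_gt0; case: p => [|p].
  have := num_ballotE 0 (leqnSn n); case: n n_gt0 => // m _.
  by rewrite /= !bin0 => /(@addIn 1 _ 0) ->.
have n0 : (n%:R != 0 :> rat)%R by rewrite Num.Theory.pnatr_eq0 -lt0n.
apply: (mulfI n0).
by rewrite -natrM mul_num_ballot /= natrM !mulrA divff ?mul1r.
Qed.

Lemma num_avoiding_UD_pow n k :
  num_avoiding n (UD_pow k) = \sum_(0 <= p < k) num_ballot n n p.
Proof.
rewrite /num_avoiding.
rewrite (@card_tuple_words _ (fun w => dyck_path n w && avoids (UD_pow k) w)).
have /eq_in_count -> : {in words n.*2,
    (fun w => dyck_path n w && avoids (UD_pow k) w) =1
    (fun w => ballot n n w && (peaks w < k))}.
  move=> w; rewrite mem_words dyck_pathE => ->.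
  by rewrite /avoids /contains (subseq_UD_pow w k).1 -ltnNge.
elim: k => [|k IHk].
  rewrite big_geq // -[RHS](count_pred0 (words n.*2)).
  by apply: eq_count => w; rewrite andbF.
rewrite big_nat_recr //= -IHk /num_ballot addnn -count_predUI.
rewrite [X in _ = _ + X](@eq_count _ _ pred0) ?count_pred0 ?addn0.
  apply: eq_count => w.
  by rewrite /= /ballot_peaks -andb_orr ltnS leq_eqVlt orbC.
by move=> w; rewrite /= /ballot_peaks; case: ltngtP; rewrite ?andbF.
Qed.

Theorem mainTheorem3 (k n : nat) (hk : 1 <= k) (hn : 1 <= n) :
  ((num_avoiding n (UD_pow k))%:R = \sum_(0 <= i < k) narayana n i :> rat)%R.
Proof.
rewrite num_avoiding_UD_pow natr_sum.
by apply: eq_bigr => p _; rewrite num_ballot_narayana.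
Qed.
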